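(* Let $G$ be a connected graph of order $n$ with $m$ edges, maximum degree $\Delta$, minimum non-pendent vertex degree $\delta_1$, and $p$ pendent vertices. Then \[ AG(G) \le \frac{p(\Delta+1)}{2\sqrt{\Delta}} + \frac{1}{2\delta_1}\sqrt{F + 2M_2 - p(\delta_1+1)^2 + 4\Delta^2 (m-p)(m-p-1)}, \] with equality if and only if $G$ is isomorphic to $K_{1,n-1}$, or $G$ is a regular graph, or $G$ is a $(\Delta,1)$-semiregular graph.
   Context: All graphs are finite, simple and undirected. $d_i$ is the degree of vertex $v_i$; $i\sim j$ denotes an edge $v_iv_j$ and sums over $i\sim j$ run over edges, each once. A pendent vertex is a vertex of degree $1$; $p$ is the number of pendent vertices; $\delta_1$ is the minimum degree among non-pendent vertices. $AG(G)=\sum_{i\sim j}\frac12\left(\sqrt{d_i/d_j}+\sqrt{d_j/d_i}\right)$, $F(G)=\sum_i d_i^3$, $M_2(G)=\sum_{i\sim j} d_id_j$. A graph is $(s,r)$-semiregular if its vertex set is the disjoint union of two nonempty sets $V_1,V_2$ with all vertices of $V_1$ of degree $s$ and all vertices of $V_2$ of degree $r$. $K_{1,n-1}$ is the star. *)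

(* Defs.v *)
From mathcomp Require Import all_boot all_order all_algebra.

Set Implicit Arguments.
Unset Strict Implicit.
Unset Printing Implicit Defensive.

Import Order.TTheory GRing.Theory Num.Theory.

Record sgraph := SGraph {
  vertex :> finType;
  adj : rel vertex;
  adj_sym : symmetric adj;
  adj_irrefl : irreflexive adj }.

(* Each undirected edge is represented once, by its orientation that increases
   along the enumeration of the vertex type.  Every quantity summed over
   [edges] below is symmetric in the endpoints, so this choice is immaterial. *)
Definition edges (G : sgraph) : {set G * G} :=
  [set u | adj u.1 u.2 && (enum_rank u.1 < enum_rank u.2)].

Definition deg (G : sgraph) (x : G) : nat := #|[set y | adj x y]|.

Definition max_degree (G : sgraph) : nat := \max_(x : G) deg x.

Definition pendent (G : sgraph) (x : G) : bool := deg x == 1.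

Definition num_pendent (G : sgraph) : nat := #|[set x : G | pendent x]|.

(* Relational because the minimum exists only if some vertex is non-pendent;
   among connected graphs this excludes exactly K_2. *)
Definition min_nonpendent_degree (G : sgraph) (d : nat) : Prop :=
  (exists2 x : G, ~~ pendent x & deg x = d) /\
  (forall x : G, ~~ pendent x -> d <= deg x).

Definition connected (G : sgraph) : Prop :=
  0 < #|vertex G| /\ forall x y : G, connect (@adj G) x y.

Definition isomorphic (G H : sgraph) : Prop :=
  exists2 f : G -> H, bijective f & forall x y : G, adj (f x) (f y) = adj x y.

Definition regular (G : sgraph) : Prop := exists k, forall x : G, deg x = k.

(* As used here, semiregularity does not require V1 and V2 to be independent
   sets. *)
Definition semiregular (G : sgraph) (s r : nat) : Prop :=
  exists V1 V2 : {set G},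
    [/\ V1 != set0, V2 != set0, [disjoint V1 & V2] & V1 :|: V2 = [set: G]] /\
    (forall x, x \in V1 -> deg x = s) /\ (forall x, x \in V2 -> deg x = r).

Definition is_left (A B : Type) (x : A + B) : bool :=
  if x is inl _ then true else false.

Definition Kbip_adj (a b : nat) : rel ('I_a + 'I_b)%type :=
  fun x y => is_left x != is_left y.

Lemma Kbip_sym a b : symmetric (@Kbip_adj a b).
Proof. by move=> x y; rewrite /Kbip_adj eq_sym. Qed.

Lemma Kbip_irrefl a b : irreflexive (@Kbip_adj a b).
Proof. by move=> x; rewrite /Kbip_adj eqxx. Qed.

Definition Kbip (a b : nat) : sgraph :=
  SGraph (@Kbip_sym a b) (@Kbip_irrefl a b).

Definition F_index (G : sgraph) : nat := \sum_(x : G) deg x ^ 3.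

Definition M2_index (G : sgraph) : nat :=
  \sum_(u in edges G) deg u.1 * deg u.2.

Local Open Scope ring_scope.

Definition AG_index (R : rcfType) (G : sgraph) : R :=
  \sum_(u in edges G)
    2^-1 * (Num.sqrt ((deg u.1)%:R / (deg u.2)%:R) +
            Num.sqrt ((deg u.2)%:R / (deg u.1)%:R)).

(* Main.v *)
(* F + 2 M_2 is the sum of (d_i + d_j)^2 over the edges, so the edges can be
   treated one by one.  A pendent edge whose other end has degree q contributes
   (q + 1) / (2 sqrt q), increasing in q >= 1; an edge between non-pendent
   vertices contributes at most (d_i + d_j) / (2 delta_1).  The square of the
   sum of d_i + d_j over the latter edges is expanded and its off-diagonal terms
   are bounded by (2 Delta)^2, while each (q + 1)^2 is at least
   (delta_1 + 1)^2.  An edge at a vertex of degree Delta makes one of these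
   steps strict unless delta_1 = Delta.  Hence equality holds exactly when all
   non-pendent vertices have degree Delta, and this is what the three extremal
   families amount to. *)
Require Import Defs.
From mathcomp Require Import all_boot all_order all_algebra.
From mathcomp Require Import zify ring lra.

Set Implicit Arguments.
Unset Strict Implicit.
Unset Printing Implicit Defensive.

Import Order.TTheory GRing.Theory Num.Theory.

(** * Double counting over edges *)

Lemma adj_neq (G : sgraph) (x y : G) : adj x y -> x != y.
Proof. by apply: contraTneq => ->; rewrite adj_irrefl. Qed.

(** Reversing orientations turns the terms [h u.2] into terms [h u.1] over the decreasing pairs.
    Together the two sums run over all ordered adjacent pairs, where each [x] comes first [deg x]
    times. *)
Lemma handshake (G : sgraph) (h : G -> nat) :
  \sum_(u in edges G) (h u.1 + h u.2) = \sum_(x : G) deg x * h x.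
Proof.
pose swap (u : G * G) := (u.2, u.1).
have swapK : involutive swap by case.
rewrite big_split /= [X in _ + X](reindex_inj (inv_inj swapK)) /=.
transitivity (\sum_(u : G * G | adj u.1 u.2) h u.1).
  rewrite [RHS](bigID (fun u => enum_rank u.1 < enum_rank u.2)) /=.
  congr (_ + _); apply: eq_bigl => u; rewrite inE //= adj_sym.
  case uv: (adj u.1 u.2) => //=; rewrite -leqNgt ltn_neqAle.
  by rewrite (inj_eq val_inj) (inj_eq enum_rank_inj) eq_sym adj_neq.
rewrite -(pair_big_dep xpredT (fun x y => adj x y) (fun x y => h x)) /=.
by apply: eq_bigr => x _; rewrite sum_nat_const /deg cardsE.
Qed.

Lemma F_plus_2M2 (G : sgraph) :
  F_index G + 2 * M2_index G = \sum_(u in edges G) (deg u.1 + deg u.2) ^ 2.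
Proof.
have -> : F_index G = \sum_(u in edges G) (deg u.1 ^ 2 + deg u.2 ^ 2).
  by rewrite (handshake (fun x => deg x ^ 2)); apply: eq_bigr => x _;
    rewrite expnS.
by rewrite big_distrr -big_split; apply: eq_bigr => u _ /=; rewrite sqrnD.
Qed.

Lemma incident_edge (G : sgraph) (x y : G) :
  adj x y -> exists2 u, u \in edges G & x = u.1 \/ x = u.2.
Proof.
move=> xy; case: (ltngtP (enum_rank x) (enum_rank y)) => r.
- by exists (x, y); [rewrite inE xy | left].
- by exists (y, x); [rewrite inE adj_sym xy | right].
by have := adj_neq xy; rewrite (enum_rank_inj (val_inj r)) eqxx.
Qed.

Lemma deg_gt0P (G : sgraph) (x : G) : reflect (exists y, adj x y) (0 < deg x).
Proof.
apply: (iffP card_gt0P) => -[y]; first by rewrite inE; exists y.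
by move=> xy; exists y; rewrite inE.
Qed.

Lemma edge_deg_gt0 (G : sgraph) (u : G * G) :
  u \in edges G -> 0 < deg u.1 /\ 0 < deg u.2.
Proof.
rewrite inE => /andP[uv _]; split; apply/deg_gt0P; first by exists u.2.
by exists u.1; rewrite adj_sym.
Qed.

(** * Consequences of connectedness *)

Lemma connected_closed (G : sgraph) (A : {set G}) (x : G) :
    connected G -> x \in A ->
    (forall y z, y \in A -> adj y z -> z \in A) -> A = [set: G].
Proof.
move=> [_ Gc] xA Acl; apply/setP => y; rewrite inE.
case/connectP: (Gc x y) => s + ->.
elim: s x xA => //= z s IHs x xA /andP[xz]; apply: IHs; exact: Acl xz.
Qed.

Lemma connected_deg0 (G : sgraph) (x y : G) :
  connected G -> deg x = 0 -> y = x.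
Proof.
move=> Gc x0; apply/set1P; rewrite (connected_closed Gc (set11 x)) ?inE //.
move=> z t /set1P-> xt; suff: 0 < deg x by rewrite x0.
by apply/deg_gt0P; exists t.
Qed.

Lemma pendent_adj_eq (G : sgraph) (x y z : G) :
  pendent x -> adj x y -> adj x z -> z = y.
Proof.
move=> /cards1P[t /setP xt] xy xz.
by have := xt y; have := xt z; rewrite !inE xy xz => /esym/eqP-> /esym/eqP->.
Qed.

(** Two adjacent pendent vertices form a set closed under adjacency, hence the whole graph; the
    non-pendent [w] excludes this case, which is K_2. *)
Lemma adj_pendent (G : sgraph) (x y w : G) :
  connected G -> ~~ pendent w -> adj x y -> pendent x -> ~~ pendent y.
Proof.
move=> Gc npw xy px; apply/negP => py; case/negP: npw.
have : w \in [set x; y].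
  rewrite (connected_closed Gc (set21 x y)) ?inE // => z t /set2P[]-> zt.
    by rewrite (pendent_adj_eq px xy zt) set22.
  by rewrite adj_sym in xy; rewrite (pendent_adj_eq py xy zt) set21.
by case/set2P => ->.
Qed.

(** * Pendent and inner edges *)

Definition pendent_edges (G : sgraph) : {set G * G} :=
  [set u in edges G | pendent u.1 || pendent u.2].

Definition inner_edges (G : sgraph) : {set G * G} :=
  [set u in edges G | ~~ (pendent u.1 || pendent u.2)].

Lemma sum_edges_split (V : nmodType) (G : sgraph) (f : G * G -> V) :
  (\sum_(u in edges G) f u =
   \sum_(u in pendent_edges G) f u + \sum_(u in inner_edges G) f u)%R.
Proof.
rewrite (bigID (fun u => pendent u.1 || pendent u.2)) /=.
by congr (_ + _)%R; apply: eq_bigl => u; rewrite [RHS]inE.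
Qed.

Lemma card_edges_split (G : sgraph) :
  #|edges G| = #|pendent_edges G| + #|inner_edges G|.
Proof. by rewrite -!sum1_card sum_edges_split. Qed.

(** Apply [handshake] to the indicator of pendency: a pendent edge has exactly one pendent end and
    counts 1, an inner edge counts 0. *)
Lemma card_pendent_edges (G : sgraph) (w : G) :
  connected G -> ~~ pendent w -> #|pendent_edges G| = num_pendent G.
Proof.
move=> Gc npw.
have -> : num_pendent G = \sum_(x : G) deg x * pendent x.
  rewrite /num_pendent -sum1_card (eq_bigl (@pendent G)); last first.
    by move=> x; rewrite inE.
  rewrite big_mkcond; apply: eq_bigr => x _; rewrite /pendent.
  by case: eqP => [->|]; rewrite ?muln0.
rewrite -(handshake (fun x => nat_of_bool (pendent x))) -sum1_card.
rewrite sum_edges_split /= [X in _ = (_ + X)%R]big1 => [|u]; last first.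
  by rewrite !inE negb_or => /andP[_ /andP[/negbTE-> /negbTE->]].
rewrite GRing.addr0; apply: eq_bigr => u; rewrite !inE.
case/andP=> /andP[uv _]; case pu: (pendent u.1) => /=; last by move->.
by rewrite (negbTE (adj_pendent Gc npw uv pu)).
Qed.

(** * Real inequalities for sums and single edges *)

Local Open Scope ring_scope.

(** The diagonal products are kept, and each of the |A|(|A| - 1) others is at most T^2. The
    subtraction is in the ring; for empty A the factor -1 meets a factor 0. *)
Lemma sqr_sum_le (R : realDomainType) (I : finType) (A : {set I})
    (t : I -> R) (T : R) :
    (forall i, i \in A -> 0 <= t i <= T) ->
  (\sum_(i in A) t i) ^+ 2 <=
  \sum_(i in A) t i ^+ 2 + T ^+ 2 * #|A|%:R * (#|A|%:R - 1).
Proof.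
(* The left side becomes the sum over i of [t i] times the sum of all other [t j], to be compared
   termwise with T times T(|A| - 1). *)
move=> tT; rewrite -lerBlDl expr2 mulr_suml -sumrB.
have -> : T ^+ 2 * #|A|%:R * (#|A|%:R - 1) =
          \sum_(i in A) T * (T * (#|A|%:R - 1)).
  by rewrite sumr_const -mulr_natl; ring.
apply: ler_sum => i iA; rewrite expr2 -mulrBr; have /andP[t0 tiT] := tT i iA.
have -> : \sum_(j in A) t j - t i = \sum_(j in A | j != i) t j.
  by rewrite (bigD1 i) //= addrAC subrr add0r.
rewrite ler_pM //.
  by apply: sumr_ge0 => j /andP[jA _]; case/andP: (tT j jA).
have -> : #|A|%:R - 1 = #|A :\ i|%:R :> R.
  by rewrite (cardsD1 i A) iA natrD addrAC subrr add0r.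
rewrite mulr_natr -sumr_const.
rewrite (eq_bigl (fun j => j \in A :\ i)) => [|j]; last by rewrite !inE andbC.
by apply: ler_sum => j; rewrite !inE => /andP[_ jA]; case/andP: (tT j jA).
Qed.

(** Over a common denominator the numerator is the degree sum a + b, the quantity whose squares add
    up to F + 2 M_2. *)
Lemma AG_term (R : rcfType) (a b : nat) : (0 < a)%N -> (0 < b)%N ->
  2^-1 * (Num.sqrt (a%:R / b%:R) + Num.sqrt (b%:R / a%:R)) =
  (a + b)%:R / (2 * Num.sqrt (a * b)%:R) :> R.
Proof.
move=> a0 b0.
have sa : 0 < Num.sqrt a%:R :> R by rewrite sqrtr_gt0 ltr0n.
have sb : 0 < Num.sqrt b%:R :> R by rewrite sqrtr_gt0 ltr0n.
rewrite natrM natrD !sqrtrM ?ler0n // !sqrtrV ?ler0n //.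
rewrite -[X in _ = (X + _) / _](@sqr_sqrtr _ a%:R) ?ler0n //.
rewrite -[X in _ = (_ + X) / _](@sqr_sqrtr _ b%:R) ?ler0n //.
by field; rewrite !gt_eqF.
Qed.

(** With s = sqrt q and S = sqrt D the terms are (s + 1/s)/2 and (S + 1/S)/2; their difference
    factors as (S - s)(S s - 1)/(2 S s), and S s >= 1. *)
Lemma pendent_term_le (R : rcfType) (q D : nat) : (0 < q <= D)%N ->
  (q%:R + 1) / (2 * Num.sqrt q%:R) <= (D%:R + 1) / (2 * Num.sqrt D%:R) :> R.
Proof.
move=> /andP[q0 qD].
have s1 : 1 <= Num.sqrt q%:R :> R by rewrite -[leLHS]sqrtr1 ler_wsqrtr ?ler1n.
have sS : Num.sqrt q%:R <= Num.sqrt D%:R :> R.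
  by rewrite ler_wsqrtr ?ler_nat.
rewrite -[X in (X + 1) / _](@sqr_sqrtr _ q%:R) ?ler0n //.
rewrite -[X in _ <= (X + 1) / _](@sqr_sqrtr _ D%:R) ?ler0n //.
move: (Num.sqrt q%:R) (Num.sqrt D%:R) s1 sS => s S s1 sS.
have s0 : 0 < s by lra.
have S0 : 0 < S by lra.
rewrite -subr_ge0.
have -> : (S ^+ 2 + 1) / (2 * S) - (s ^+ 2 + 1) / (2 * s) =
    (S - s) * (S * s - 1) / (2 * S * s) by field; rewrite !gt_eqF.
have Ss1 : 1 <= S * s by nra.
by apply: divr_ge0; apply: mulr_ge0; rewrite ?subr_ge0 ?mulr_ge0 // ltW.
Qed.

(** The root sqrt(ab) is at least d, and equals d only for a = b = d. *)
Lemma inner_term_leif (R : rcfType) (a b d : nat) :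
    (0 < d)%N -> (d <= a)%N -> (d <= b)%N ->
  (a + b)%:R / (2 * Num.sqrt (a * b)%:R) <= (a + b)%:R / (2 * d%:R)
    ?= iff (a == d) && (b == d) :> R.
Proof.
move=> d0 da db.
have ab0 : (0 : R) < (a + b)%:R by rewrite ltr0n; lia.
have d0R : 0 < d%:R :> R by rewrite ltr0n.
have [/andP[/eqP-> /eqP->]|nab] := boolP (_ && _).
  by rewrite natrM -expr2 sqrtr_sqr ger0_norm ?ler0n //; apply/leif_refl.
have lt : d%:R < Num.sqrt (a * b)%:R :> R.
  rewrite -[ltLHS]ger0_norm ?ler0n // -sqrtr_sqr ltr_sqrt ?ltr0n; last by nia.
  by rewrite -natrX ltr_nat; nia.
apply/leifP; rewrite ltr_pM2l // ltf_pV2 ?posrE ?mulr_gt0 //.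
  by rewrite ltr_pM2l.
exact: lt_trans lt.
Qed.

(** * Maximum degree and the extremal graphs *)

Lemma max_degree_attained (G : sgraph) (w : G) :
  exists x : G, deg x = max_degree G.
Proof.
have [|x xE] := @bigop.eq_bigmax G (@deg G); first by apply/card_gt0P; exists w.
by exists x; apply: esym.
Qed.

Lemma deg_le_max (G : sgraph) (x : G) : (deg x <= max_degree G)%N.
Proof. exact: leq_bigmax. Qed.

Lemma star_deg_le1 (G : sgraph) (k : nat) :
  isomorphic G (Kbip 1 k) -> exists c : G, forall y, y != c -> (deg y <= 1)%N.
Proof.
case=> f [g gK fK] fadj; exists (g (inl ord0)) => y yc.
have fy : @Defs.is_left 'I_1 'I_k (f y) = false.
  case fyE: (f y) yc => [i|//].
  by rewrite -(gK y) fyE (ord1 i) eqxx.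
rewrite -(cards1 (g (inl ord0))); apply/subset_leq_card/subsetP => z.
rewrite !inE -fadj /= /Kbip_adj fy; case fzE: (f z) => [i|//] _.
by rewrite -(gK z) fzE (ord1 i).
Qed.

(** If d is the maximum degree, the presence or absence of a pendent vertex decides between
    semiregular and regular. Conversely, each family forces the non-pendent vertex [w] of least
    degree to have maximum degree. *)
Lemma extremal_iff (G : sgraph) (d n : nat) :
    connected G -> min_nonpendent_degree G d ->
  d = max_degree G <->
  [\/ isomorphic G (Kbip 1 n), regular G | semiregular G (max_degree G) 1].
Proof.
move=> Gc [[w npw wd] dmin].
have [x xD] := max_degree_attained w.
split=> [dD|].
  have npD (y : G) : ~~ pendent y -> deg y = max_degree G.
    by move=> npy; apply/eqP; rewrite eqn_leq deg_le_max -dD dmin.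
  have [y py|np] := pickP (@pendent G); last first.
    by apply: Or32; exists (max_degree G) => y; rewrite npD ?np.
  apply: Or33; exists [set y | ~~ pendent y], [set y | pendent y].
  split; last by split=> z; rewrite inE; [apply: npD | move/eqP].
  split; last by apply/setP => z; rewrite !inE orNb.
  - by apply/set0Pn; exists w; rewrite inE.
  - by apply/set0Pn; exists y; rewrite inE.
  by apply/pred0P => z /=; rewrite !inE andNb.
rewrite -wd.
case=> [/star_deg_le1[c c1]|[k Gk]|[V1 [V2 [[_ _ _ V12] [dV1 dV2]]]]].
(* A non-pendent vertex of degree at most 1 is isolated, hence the only vertex. Otherwise [w] and
   [x] are both the centre [c]. *)
- have w0 : (deg w <= 1)%N -> deg w = 0%N.
    by rewrite leq_eqVlt -/(pendent w) (negbTE npw) ltnS leqn0 => /eqP.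
  suff : x = w by move<-.
  have [wc|/c1/w0/(connected_deg0 x Gc)//] := eqVneq w c.
  have [xc|/c1 x1] := eqVneq x c; first by rewrite wc.
  apply: (connected_deg0 x Gc (w0 _)); apply: leq_trans x1.
  by rewrite xD deg_le_max.
- by rewrite -xD !Gk.
have : w \in V1 :|: V2 by rewrite V12 inE.
by case/setUP => [/dV1//|/dV2 w1]; rewrite /pendent w1 in npw.
Qed.

(** * The bound and its equality case for positive minimum non-pendent degree *)

Lemma AG_bound_leif (R : rcfType) (G : sgraph) (d : nat) :
    connected G -> min_nonpendent_degree G d -> (0 < d)%N ->
  let D := max_degree G in
  let m : R := #|edges G|%:R in
  let p : R := (num_pendent G)%:R in
  AG_index R G <=
    p * (D%:R + 1) / (2 * Num.sqrt D%:R) +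
    1 / (2 * d%:R) *
      Num.sqrt ((F_index G)%:R + 2 * (M2_index G)%:R - p * (d%:R + 1) ^+ 2
                + 4 * D%:R ^+ 2 * (m - p) * (m - p - 1))
  ?= iff (d == D).
Proof.
move=> Gc [[w npw wd] dmin] d_gt0 D m p.
set P := pendent_edges G; set N := inner_edges G.
pose t (u : G * G) := (deg u.1 + deg u.2)%N.
(* On a pendent edge, q is the degree of the non-pendent end. *)
pose q (u : G * G) := (deg u.1 * deg u.2)%N.
have pE : p = #|P|%:R by rewrite /p -(card_pendent_edges Gc npw).
have mpE : m - p = #|N|%:R.
  by rewrite pE /m card_edges_split natrD addrAC subrr add0r.
have pend u : u \in P -> t u = (q u).+1 /\ (d <= q u <= D)%N.
  rewrite inE => /andP[uE pu]; have [u1 u2] : adj u.1 u.2 /\ adj u.2 u.1.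
    by move: uE; rewrite inE [adj u.2 _]adj_sym => /andP[->].
  rewrite /t /q; case/orP: pu => pu.
    have := adj_pendent Gc npw u1 pu; rewrite (eqP pu) mul1n add1n => /dmin->.
    by rewrite deg_le_max.
  have := adj_pendent Gc npw u2 pu; rewrite (eqP pu) muln1 addn1 => /dmin->.
  by rewrite deg_le_max.
have inner u : u \in N -> (d <= deg u.1)%N /\ (d <= deg u.2)%N.
  by rewrite inE negb_or => /and3P[_ /dmin-> /dmin->].
(* [S] is the excess of the pendent edges over (d + 1)^2 each. The expression under the root will be
   [S + Q], where [Q] bounds [T ^+ 2] by [sqr_sum_le]. *)
pose S := \sum_(u in P) (((q u)%:R + 1) ^+ 2 - (d%:R + 1) ^+ 2) : R.
pose T := \sum_(u in N) (t u)%:R : R.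
pose AP := \sum_(u in P) ((q u)%:R + 1) / (2 * Num.sqrt (q u)%:R) : R.
pose AN := \sum_(u in N) (t u)%:R / (2 * Num.sqrt (q u)%:R) : R.
have AGE : AG_index R G = AP + AN.
  transitivity (\sum_(u in edges G) (t u)%:R / (2 * Num.sqrt (q u)%:R) : R).
    by apply: eq_bigr => u /edge_deg_gt0[u1 u2]; rewrite AG_term.
  rewrite sum_edges_split; congr (_ + _).
  by apply: eq_bigr => u /pend[-> _]; rewrite -natr1.
pose Q : R := \sum_(u in N) (t u)%:R ^+ 2
             + (2 * D%:R) ^+ 2 * #|N|%:R * (#|N|%:R - 1).
have argE : (F_index G)%:R + 2 * (M2_index G)%:R - p * (d%:R + 1) ^+ 2
    + 4 * D%:R ^+ 2 * (m - p) * (m - p - 1) =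
    S + Q.
  rewrite mpE -natrM -natrD F_plus_2M2 natr_sum sum_edges_split.
  rewrite /S /Q sumrB sumr_const pE mulr_natl exprMn -natrX.
  under eq_bigr => u /pend[tu _] do rewrite -/(t u) tu natrX -natr1.
  under [X in _ + X - _ + _]eq_bigr do rewrite natrX.
  by ring.
have S_ge0 : 0 <= S.
  apply: sumr_ge0 => u /pend[_ /andP[dq _]].
  by rewrite subr_ge0 !natr1 -!natrX ler_nat leq_sqr ltnS.
have T_le : T ^+ 2 <= Q.
  apply: sqr_sum_le => u _; rewrite ler0n -natrM ler_nat mul2n -addnn.
  by rewrite leq_add ?deg_le_max.
have T_ge0 : 0 <= T by apply: sumr_ge0 => u _; rewrite ler0n.
have AP_le : AP <= p * (D%:R + 1) / (2 * Num.sqrt D%:R).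
  rewrite -mulrA pE mulr_natl -sumr_const.
  apply: ler_sum => u /pend[_ /andP[dq qD]].
  by apply: pendent_term_le; rewrite qD (leq_trans d_gt0).
have AN_le : AN <= 1 / (2 * d%:R) * T
    ?= iff [forall (u | u \in N), (deg u.1 == d) && (deg u.2 == d)].
  rewrite mulrC mul1r mulr_suml; apply: leif_sum => u /inner[u1 u2].
  exact: inner_term_leif.
rewrite argE AGE; apply/leifP.
have d2_gt0 : 0 < (2 * d%:R)^-1 :> R by rewrite invr_gt0 mulr_gt0 ?ltr0n.
(* If d = D, all estimates are equalities: S = 0, Q = T^2, and the bounds on [AP] and [AN] are
   attained. *)
case: eqVneq => [dD|ndD].
  have degP u : u \in P -> q u = d.
    case/pend => _; rewrite -dD => /andP[dq qd].
    by apply/eqP; rewrite eqn_leq qd.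
  have degN u : u \in N -> deg u.1 = d /\ deg u.2 = d.
    by case/inner=> u1 u2; split; apply/eqP; rewrite eqn_leq dD deg_le_max -dD.
  have -> : AN = 1 / (2 * d%:R) * T.
    apply/eqP; rewrite AN_le; apply/forall_inP => u /degN[-> ->].
    by rewrite !eqxx.
  have TE : T = #|N|%:R * (2 * d%:R).
    rewrite mulr_natl -sumr_const; apply: eq_bigr => u /degN[u1 u2].
    by rewrite /t u1 u2 addnn -mul2n natrM.
  have S0 : S = 0 by apply: big1 => u /degP->; rewrite subrr.
  have QE : Q = T ^+ 2.
    rewrite /Q (eq_bigr (fun=> (2 * d%:R) ^+ 2)) => [|u /degN[u1 u2]].
      by rewrite sumr_const -mulr_natl -dD TE; ring.
    by rewrite /t u1 u2 addnn -mul2n natrM.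
  have -> : AP = p * (D%:R + 1) / (2 * Num.sqrt D%:R).
    rewrite -mulrA pE mulr_natl -sumr_const.
    by apply: eq_bigr => u /degP->; rewrite dD.
  by rewrite S0 add0r QE sqrtr_sqr ger0_norm // mul1r.
have T_sqrt : T <= Num.sqrt Q by rewrite -[T]ger0_norm // -sqrtr_sqr ler_wsqrtr.
have sqrt_le : Num.sqrt Q <= Num.sqrt (S + Q) by rewrite ler_wsqrtr ?lerDr.
(* One edge at a vertex of maximum degree suffices for strictness. *)
have [x xD] := max_degree_attained w.
have /deg_gt0P[y xy] : (0 < deg x)%N.
  by rewrite xD (leq_trans d_gt0) // -wd deg_le_max.
have [u uE xu] := incident_edge xy.
have [uP|uN] : u \in P \/ u \in N.
- by rewrite [_ \in P]inE [_ \in N]inE uE /=; case: (_ || _); [left | right].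
(* Pendent case: [q u] is at most D and has D as a factor, so it equals D > d. Then S > 0 makes the
   root strictly larger than sqrt Q. *)
- have S_gt0 : 0 < S.
    have [_ /andP[dq qD]] := pend u uP.
    have qE : q u = D.
      have [u1 u2] := edge_deg_gt0 uE.
      apply/eqP; rewrite eqn_leq qD /D -xD /q.
      by case: xu => ->; [apply: leq_pmulr | apply: leq_pmull].
    rewrite /S (bigD1 u) //= ltr_pwDl //.
      rewrite subr_gt0 !natr1 -!natrX ltr_nat ltn_sqr ltnS qE.
      by rewrite ltn_neqAle ndD -qE.
    apply: sumr_ge0 => v /andP[/pend[_ /andP[dv _]] _].
    by rewrite subr_ge0 !natr1 -!natrX ler_nat leq_sqr ltnS.
  apply: ler_ltD => //; apply: le_lt_trans AN_le.1 _.
  rewrite mul1r ltr_pM2l //; apply: le_lt_trans T_sqrt _.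
  by rewrite ltr_sqrt ?ltrDr // ltr_wpDr // (le_trans _ T_le) ?sqr_ge0.
(* Inner case: one end has degree D, not d, so the estimate of [AN] is strict. *)
apply: ler_ltD => //; apply: (@lt_le_trans _ _ (1 / (2 * d%:R) * T)).
  rewrite (lt_leif AN_le); apply/forall_inP => /(_ u uN) /andP[/eqP u1 /eqP u2].
  by move/eqP: ndD; apply; rewrite /D -xD; case: xu => ->.
by rewrite mul1r ler_pM2l // (le_trans T_sqrt).
Qed.

(** * The one-vertex graph and the conclusion *)

Lemma deg0_no_edges (G : sgraph) (w : G) :
  connected G -> deg w = 0%N -> edges G = set0.
Proof.
move=> Gc w0; apply/setP => u; rewrite !inE.
by rewrite (connected_deg0 u.1 Gc w0) (connected_deg0 u.2 Gc w0) ltnn andbF.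
Qed.

Theorem theorem2 (R : rcfType) (G : sgraph) (n m p Delta delta1 : nat)
    (G_connected : connected G)
    (nE : #|vertex G| = n)
    (mE : #|edges G| = m)
    (DeltaE : max_degree G = Delta)
    (delta1P : min_nonpendent_degree G delta1)
    (pE : num_pendent G = p) :
  let bound : R :=
    p%:R * (Delta%:R + 1) / (2 * Num.sqrt Delta%:R) +
    1 / (2 * delta1%:R) *
      Num.sqrt ((F_index G)%:R + 2 * (M2_index G)%:R
                - p%:R * (delta1%:R + 1) ^+ 2
                + 4 * Delta%:R ^+ 2 * (m%:R - p%:R) * (m%:R - p%:R - 1)) in
  AG_index R G <= bound /\
  (AG_index R G = bound <->
     [\/ isomorphic G (Kbip 1 n.-1), regular G | semiregular G Delta 1]).
Proof.
move=> bound; suff le : AG_index R G <= bound ?= iff (delta1 == Delta).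
  split; first exact: le.1.
  rewrite -DeltaE -(extremal_iff n.-1 G_connected delta1P) DeltaE.
  by split=> E; apply/eqP; [rewrite -le.2 | rewrite le.2]; apply/eqP.
(* If delta1 = 0, the graph is a single vertex: there are no edges, and both sides are 0 under the
   convention that the inverse of 0 is 0. The equality condition holds as Delta = 0. *)
have [delta1_0|delta1_gt0] := posnP delta1; last first.
  have := AG_bound_leif R G_connected delta1P delta1_gt0.
  by rewrite mE pE DeltaE.
have [[w npw w0] _] := delta1P; rewrite delta1_0 in w0.
have Delta0 : Delta = 0%N.
  rewrite -DeltaE; have [x <-] := max_degree_attained w.
  by rewrite (connected_deg0 x G_connected w0).
have E0 := deg0_no_edges G_connected w0.
have p0 : p = 0%N.
  rewrite -pE; apply: eq_card0 => x; rewrite !inE.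
  by rewrite (connected_deg0 x G_connected w0) (negbTE npw).
rewrite delta1_0 Delta0 eqxx /bound p0 delta1_0 /AG_index E0 big_set0.
by rewrite !mulr0 invr0 !mul0r mulr0 !mul0r addr0; apply/leif_refl.
Qed.
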